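(* Let $\mathbf{x}_t=(1,0,(1\otimes1)t)\in\{1\}\oplus\mathbb{R}\oplus(\mathbb{R}\otimes\mathbb{R})$ (a non-geometric rough path lying above the constant path $0\in\mathbb{R}$) and let $f:\mathbb{R}^2\to L(\mathbb{R},\mathbb{R}^2)\simeq\mathbb{R}^2$ be the vector field of linear growth $$f(\xi)=(\sin(\xi_2)\,\xi_1,\ \xi_1),\qquad \xi=(\xi_1,\xi_2)\in\mathbb{R}^2 .$$ Let $a=(a_1,0)$ with $a_1>0$. Then the solution $y$ of the rough differential equation $y_t=a+\int_0^tf(y_s)\,\mathrm{d}\mathbf{x}_s$ explodes in finite time: $(y_t)_2=0$ and $(y_t)_1=a_1+\int_0^t(y_s)_1^2\,\mathrm{d}s$, so $(y_t)_1\to+\infty$ in finite time.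
   Context: Here $2\le p<3$ and, for $s\le t$, $\mathbf{x}_{s,t}=\mathbf{x}_s^{-1}\otimes\mathbf{x}_t$ has first-level component $0$ and second-level component $(1\otimes1)(t-s)$. Set $(f\cdot\nabla f)(\xi)(u\otimes w)=\nabla f(\xi)(f(\xi)u)\,w$. A solution of the rough differential equation on an interval $[0,\tau)$ is a continuous path $y$ with $y_0=a$ such that on every compact subinterval, for some $\theta>1$ and $C$, $$\left|y_t-y_s-f(y_s)\,\pi_{\mathbb{R}}(\mathbf{x}_{s,t})-(f\cdot\nabla f)(y_s)\,\pi_{\mathbb{R}\otimes\mathbb{R}}(\mathbf{x}_{s,t})\right|\le C|t-s|^{\theta},$$ where $\pi_{\mathbb{R}}$ and $\pi_{\mathbb{R}\otimes\mathbb{R}}$ are the first- and second-level projections. It explodes at the finite time $\tau$ if $|y_t|\to+\infty$ as $t\to\tau^-$. *)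

(* Defs.v *)
From HB Require Import structures.
From mathcomp Require Import all_boot all_order all_algebra.
From mathcomp Require Import all_classical all_reals all_analysis.

Set Implicit Arguments.
Unset Strict Implicit.
Unset Printing Implicit Defensive.

Import Order.TTheory GRing.Theory Num.Theory.
Import numFieldNormedType.Exports.

Local Open Scope classical_set_scope.
Local Open Scope ring_scope.

(* R (x) R is identified with R through its basis vector 1 (x) 1, so that
   u (x) w is (u * w) times 1 (x) 1. *)
Definition tens (R : realType) (u w : R) : R := u * w.

(* An element (1, v, z) of {1} (+) R (+) (R (x) R); the scalar component, always
   equal to 1, is not recorded. *)
Record T2 (R : realType) := MkT2 { lvl1 : R ; lvl2 : R }.

(* Product of the tensor algebra truncated above level 2:
   (1 + v + z) (x) (1 + v' + z') = 1 + (v + v') + (z + v (x) v' + z'). *)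
Definition mulT (R : realType) (g h : T2 R) : T2 R :=
  MkT2 (lvl1 g + lvl1 h) (lvl2 g + tens (lvl1 g) (lvl1 h) + lvl2 h).

Definition oneT (R : realType) : T2 R := MkT2 0 0.

Definition invT (R : realType) (g : T2 R) : T2 R :=
  MkT2 (- lvl1 g) (tens (lvl1 g) (lvl1 g) - lvl2 g).

Lemma mulVT (R : realType) (g : T2 R) : mulT (invT g) g = oneT R.
Proof.
case: g => v z; rewrite /mulT /invT /oneT /tens /=; congr MkT2.
  by rewrite addNr.
by rewrite mulNr addrAC subrK subrr.
Qed.

Lemma mulTV (R : realType) (g : T2 R) : mulT g (invT g) = oneT R.
Proof.
case: g => v z; rewrite /mulT /invT /oneT /tens /=; congr MkT2.
  by rewrite addrN.
by rewrite mulrN addrA subrK subrr.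
Qed.

Definition incr (R : realType) (x : R -> T2 R) (s t : R) : T2 R :=
  mulT (invT (x s)) (x t).

Definition is_control (R : realType) (T : R) (w : R * R -> R) : Prop :=
  [/\ {within [set st : R * R | 0 <= st.1 <= st.2 /\ st.2 <= T], continuous w},
      (forall s t : R, 0 <= s -> s <= t -> t <= T -> 0 <= w (s, t)),
      (forall s : R, 0 <= s -> s <= T -> w (s, s) = 0) &
      (forall s r t : R, 0 <= s -> s <= r -> r <= t -> t <= T ->
         w (s, r) + w (r, t) <= w (s, t))].

(* Rough path on [0, +oo[ of finite p-variation (2 <= p < 3): on every [0, T],
   level i of the increments is dominated by w(s, t)^(i/p) for a control w.
   Chen's relation holds by construction of [incr]. *)
Definition rough_path (R : realType) (p : R) (x : R -> T2 R) : Prop :=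
  forall T : R, 0 < T -> exists w : R * R -> R, is_control T w /\
    forall s t : R, 0 <= s -> s <= t -> t <= T ->
      `|lvl1 (incr x s t)| <= w (s, t) `^ (1 / p) /\
      `|lvl2 (incr x s t)| <= w (s, t) `^ (2 / p).

(* The symmetric part of level 2 is half the tensor square of level 1; every
   element of R (x) R is symmetric. Limits of lifts of smooth paths satisfy this,
   so its negation excludes geometric rough paths in both usual senses. *)
Definition weakly_geometric (R : realType) (x : R -> T2 R) : Prop :=
  forall s t : R, 0 <= s -> s <= t ->
    lvl2 (incr x s t) = tens (lvl1 (incr x s t)) (lvl1 (incr x s t)) / 2.

Definition lies_above (R : realType) (x : R -> T2 R) (b : R -> R) : Prop :=
  forall t : R, 0 <= t -> lvl1 (x t) = b t.

(* Vector fields E -> L(R, E) are given through L(R, E) ~ E, evaluation at 1. *)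
Definition vf_app (R : realType) (E : normedModType R) (f : E -> E)
  (xi : E) (u : R) : E := u *: f xi.

Definition linear_growth (R : realType) (E : normedModType R) (f : E -> E) :
    Prop :=
  exists C : R, forall xi : E, `|f xi| <= C * (1 + `|xi|).

(* (f . grad f)(xi), as a linear map on R (x) R; see [fgradf_tens]. *)
Definition fgradf (R : realType) (E : normedModType R) (f : E -> E)
  (xi : E) (z : R) : E := z *: ('d f xi (vf_app f xi 1) : E).

Lemma fgradf_tens (R : realType) (E : normedModType R) (f : E -> E)
    (xi : E) (u w : R) :
  fgradf f xi (tens u w) = w *: ('d f xi (vf_app f xi u) : E).
Proof.
by rewrite /fgradf /vf_app /tens scale1r linearZ /= scalerA mulrC.
Qed.

Definition rde_solution (R : realType) (E : normedModType R) (f : E -> E)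
    (x : R -> T2 R) (a : E) (tau : R) (y : R -> E) : Prop :=
  [/\ {within `[0, tau[, continuous y},
      y 0 = a &
      forall u v : R, 0 <= u -> u <= v -> v < tau ->
      exists theta C : R, 1 < theta /\
        forall s t : R, u <= s -> s <= t -> t <= v ->
          `|y t - y s - vf_app f (y s) (lvl1 (incr x s t))
                      - fgradf f (y s) (lvl2 (incr x s t))|
            <= C * `|t - s| `^ theta].

Definition explodes_at (R : realType) (E : normedModType R) (tau : R)
  (y : R -> E) : Prop := `|y t| @[t --> tau^'-] --> +oo.

(* Main.v *)
Require Import Defs.
From HB Require Import structures.
From mathcomp Require Import all_boot all_order all_algebra.
From mathcomp Require Import all_classical all_reals all_analysis.
From mathcomp Require Import ring lra.

Import Order.TTheory GRing.Theory Num.Theory.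
Import numFieldNormedType.Exports.

Local Open Scope classical_set_scope.
Local Open Scope ring_scope.

(** The increments of the driving path are [(1, 0, t - s)]: the first level is
    silent and the second one is Lebesgue time. For the field
    [f xi = (sin xi_2 * xi_1, xi_1)] the second-order term of the Davie expansion
    is [f . grad f = drift], with
    [drift xi = (cos xi_2 * xi_1^2 + sin^2 xi_2 * xi_1, sin xi_2 * xi_1)]
    ([fgradf_sine_field]). The rough differential equation is therefore the
    ordinary equation [y' = drift y]: although [f] has linear growth, [drift]
    grows quadratically on the axis [xi_2 = 0], where it reduces to
    [xi_1' = xi_1^2].

    Existence is explicit: [blowup a t = a / (1 - a * t)] solves [u' = u^2], and
    the path [(blowup a t, 0)] satisfies the Davie estimate with exponent 2
    because the remainder is exactly
    [(t - s)^2 * blowup a s ^ 2 * blowup a t] ([rde_solution_blowup]).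

    For uniqueness, an increment estimate with exponent [theta > 1] forces any
    solution [z] to be differentiable with [z' = drift z]
    ([is_derive_of_increments], [rde_solution_is_derive]). Both [z_2] and
    [(1 - a * t) * z_1 - a] then vanish at time 0 and satisfy [|w'| <= M * |w|]
    on compact intervals, so they vanish identically by Gronwall's lemma
    ([gronwall_eq0], [rde_solution_first_integrals]). The identity
    [(1 - a * t) * z_1 = a] determines [z], and at [t = 1 / a] it reads
    [0 = a], so no solution lives beyond the explosion time. *)

(** * The driving path *)

Definition area_path {R : realType} (t : R) : T2 R := MkT2 0 (t * tens 1 1).

Lemma lvl1_incr_area_path (R : realType) (s t : R) :
  lvl1 (incr area_path s t) = 0.
Proof. by rewrite /incr /= oppr0 addr0. Qed.

Lemma lvl2_incr_area_path (R : realType) (s t : R) :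
  lvl2 (incr area_path s t) = t - s.
Proof. by rewrite /incr /= /tens; ring. Qed.

Lemma rough_path_area_path (R : realType) (p : R) :
  2 <= p -> rough_path p area_path.
Proof.
move=> p2 T T0; have p0 : 0 < p by lra.
(* The linear control [c * (t - s)] is enough on a bounded interval: as
   [2 / p <= 1], [h <= T * (h / T) `^ (2 / p)] for [0 <= h <= T], and the right
   side is [(c * h) `^ (2 / p)] for this [c]. *)
pose c := T `^ (p / 2) / T.
have c0 : 0 <= c by rewrite divr_ge0// ?powR_ge0// ltW.
exists (fun st => c * (st.2 - st.1)); split.
  split => [|s t _ st _|s _ _|s r t _ _ _ _] /=.
  - apply: continuous_subspaceT => st.
    apply: cvgM; first exact: cvg_cst.
    by apply: cvgB; [exact: cvg_snd|exact: cvg_fst].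
  - by rewrite mulr_ge0// subr_ge0.
  - by rewrite subrr mulr0.
  - by rewrite le_eqVlt; apply/orP; left; apply/eqP; ring.
move=> s t s0 st tT.
rewrite lvl1_incr_area_path lvl2_incr_area_path normr0 powR_ge0; split => //.
have h0 : 0 <= t - s by rewrite subr_ge0.
rewrite ger0_norm//.
have [->|hn0] := eqVneq (t - s) 0; first exact: powR_ge0.
have hT : 0 < (t - s) / T <= 1.
  rewrite divr_gt0//= ?lt_neqAle 1?eq_sym ?hn0//.
  by rewrite ler_pdivrMr//; lra.
have -> : c * (t - s) = T `^ (p / 2) * ((t - s) / T) by rewrite /c; ring.
case/andP: (hT) => hT0 _.
rewrite powRM ?powR_ge0 ?(ltW hT0)// -powRrM.
have -> : p / 2 * (2 / p) = 1 by field; lra.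
rewrite powRr1 ?(ltW T0)// -ler_pdivrMl// mulrC.
by rewrite ger1_powR// ler_pdivrMr//; lra.
Qed.

Lemma not_weakly_geometric_area_path (R : realType) :
  ~ weakly_geometric (@area_path R).
Proof.
move=> /(_ 0 1 (lexx _) ler01).
rewrite lvl1_incr_area_path lvl2_incr_area_path /tens; lra.
Qed.

(** * The vector field and its second-order term *)

Definition sine_field {R : realType} (xi : R * R) : R * R :=
  (sin xi.2 * xi.1, xi.1).

Lemma linear_growth_sine_field (R : realType) : linear_growth (@sine_field R).
Proof.
exists 1 => xi; rewrite mul1r.
have h : `|xi.1| <= `|xi| by rewrite prod_normE le_max lexx.
rewrite [leLHS]prod_normE ge_max /=; apply/andP; split; last lra.
rewrite normrM (@le_trans _ _ `|xi.1|)//; last lra.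
by rewrite ler_piMl// ler_norml sin_geN1 sin_le1.
Qed.

(** [(f . grad f)(xi) (1 (x) 1)] for [f = sine_field]. *)
Definition drift {R : realType} (xi : R * R) : R * R :=
  (cos xi.2 * xi.1 ^+ 2 + sin xi.2 ^+ 2 * xi.1, sin xi.2 * xi.1).

Lemma is_diff_fst (R : realType) (xi : R * R) : is_diff xi fst fst.
Proof.
have c : continuous (fst : R * R -> R) by move=> ?; exact: cvg_fst.
by apply: DiffDef; [exact: linear_differentiable|rewrite diff_lin].
Qed.

Lemma is_diff_snd (R : realType) (xi : R * R) : is_diff xi snd snd.
Proof.
have c : continuous (snd : R * R -> R) by move=> ?; exact: cvg_snd.
by apply: DiffDef; [exact: linear_differentiable|rewrite diff_lin].
Qed.

Lemma is_diff_sin (R : realType) (x : R) :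
  is_diff x (@sin R) ( *:%R^~ (cos x)).
Proof.
have d : derivable (@sin R) x 1 by exact: ex_derive.
apply: DiffDef; first exact/derivable1_diffP.
by rewrite deriv1E// derive1E derive_val.
Qed.

Lemma fgradf_sine_field (R : realType) (xi : R * R) (h : R) :
  fgradf sine_field xi h = h *: drift xi.
Proof.
have D := is_diff_pair (is_diffM (is_diff_comp (is_diff_snd R xi)
  (is_diff_sin R xi.2)) (is_diff_fst R xi)) (is_diff_fst R xi).
rewrite /fgradf; congr (_ *: _).
rewrite [X in X = _](_ : _ = 'd (fun y : R * R =>
  (((@sin R \o snd) * fst) y, y.1)) xi (vf_app sine_field xi 1))//.
rewrite diff_val /drift /vf_app /= scale1r /=.
congr pair; last exact: mul1r.
(* This is the first component of the differential, up to the pointwise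
   operations on functions, so the first goal holds by conversion. *)
transitivity (sin xi.2 * (sin xi.2 * xi.1) + xi.1 * (xi.1 * cos xi.2)) => //.
ring.
Qed.

(** * From increment estimates to differential equations *)

(** The estimate only compares [w s - w r] with the slope at the left end [r]:
    for [r = t] it gives the right derivative at once, while for [s = t] the
    slope [phi r] has to be traded for [phi t], which is where continuity of
    [phi] enters. *)
Lemma is_derive_of_increments (R : realType) (w phi : R -> R) (a b C theta t : R) :
  a < t -> t < b -> 1 < theta -> {for t, continuous phi} ->
  (forall r s, a <= r -> r <= s -> s <= b ->
     `|w s - w r - (s - r) * phi r| <= C * `|s - r| `^ theta) ->
  is_derive t 1 w (phi t).
Proof.
move=> at_ tb th cphi H; apply/is_derive1_caratheodory.
(* Caratheodory's criterion: the slope function is continuous at [t]. *)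
exists (fun s => if s == t then phi t else (w s - w t) / (s - t)).
split; [|  |by rewrite eqxx].
  move=> s; case: eqVneq => [->|st]; first by rewrite !subrr mulr0.
  by rewrite divfK// subr_eq0.
have r0 : 0 < theta - 1 by lra.
apply/cvgrPdist_lt => e e0 /=; rewrite eqxx.
pose D := `|C| + 1.
have D0 : 0 < D by rewrite /D; have := normr_ge0 C; lra.
(* [d] is chosen so that [|C| * h `^ (theta - 1) < e / 2] for [h < d]. *)
pose d := (e / 2 / D) `^ (theta - 1)^-1.
have d0 : 0 < d by rewrite powR_gt0// !divr_gt0.
have e2 : 0 < e / 2 by lra.
near=> s.
case: eqVneq => [_|st]; first by rewrite subrr normr0.
have as_ : a <= s by apply: ltW; near: s; exact: lt_nbhsr.
have sb : s <= b by apply: ltW; near: s; exact: lt_nbhsl.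
have std : `|t - s| < d.
  near: s; apply: (@cvgr_dist_lt _ _ _ _ _ id t) => //; exact: cvg_id.
have phist : `|phi t - phi s| < e / 2.
  near: s; exact: (cvgr_dist_lt _ _ cphi).
have ts0 : 0 < `|t - s| by rewrite normr_gt0 subr_eq0 eq_sym.
have K : C * `|t - s| `^ theta < e / 2 * `|t - s|.
  have -> : `|t - s| `^ theta = `|t - s| `^ (theta - 1) * `|t - s|.
    by rewrite mulrC mulr_powRB1//; lra.
  rewrite mulrA ltr_pM2r//.
  rewrite (@le_lt_trans _ _ (D * `|t - s| `^ (theta - 1)))//.
    by rewrite ler_wpM2r ?powR_ge0// /D; have := ler_norm C; lra.
  rewrite -ltr_pdivlMl// mulrC.
  have -> : e / 2 / D = d `^ (theta - 1).
    by rewrite -powRrM mulVf ?gt_eqF// powRr1// ltW// divr_gt0.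
  by rewrite gt0_ltr_powR// nnegrE// ltW.
rewrite -(ltr_pM2r ts0) -normrM mulrBl.
have -> : (w s - w t) / (s - t) * (t - s) = w t - w s.
  by field; rewrite subr_eq0.
have [lest|lets] := leP s t.
- have {}H := H s t as_ lest (ltW tb).
  have -> : phi t * (t - s) - (w t - w s) =
    (phi t - phi s) * (t - s) - (w t - w s - (t - s) * phi s) by ring.
  apply: (le_lt_trans (ler_normB _ _)); rewrite normrM.
  have : `|phi t - phi s| * `|t - s| < e / 2 * `|t - s| by rewrite ltr_pM2r.
  lra.
- have {}H := H t s (ltW at_) (ltW lets) sb.
  have -> : phi t * (t - s) - (w t - w s) =
    w s - w t - (s - t) * phi t by ring.
  rewrite (le_lt_trans H)// distrC (lt_le_trans K)// ler_pM2r//; lra.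
Unshelve. all: end_near. Qed.

(** [w ^ 2 * exp (- 2 * M * t)] has derivative
    [2 * exp (- 2 * M * t) * (w * w' - M * w ^ 2) <= 0] and vanishes at 0. *)
Lemma gronwall_eq0 (R : realType) (w dw : R -> R) (v M : R) : 0 <= v ->
  {within `[0, v], continuous w} ->
  (forall t : R, t \in `]0, v[ -> is_derive t 1 w (dw t)) ->
  (forall t : R, t \in `]0, v[ -> `|dw t| <= M * `|w t|) ->
  w 0 = 0 -> w v = 0.
Proof.
move=> v0 cw dww dwle w0.
pose E (t : R) : R := expR (- (2 * M) * t).
pose g (t : R) : R := w t ^+ 2 * E t.
have dE (t : R) : is_derive t 1 E (E t * - (2 * M)).
  rewrite /E; apply: (@is_derive1_comp _ expR ( *%R (- (2 * M)))).
  apply: (@is_derive_eq _ R R (- (2 * M) \*: id)).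
  by rewrite /GRing.scale /= mulr1.
have dg (t : R) : t \in `]0, v[ ->
    is_derive t 1 g (2 * E t * (w t * dw t - M * w t ^+ 2)).
  move=> tv; have ? := dww t tv; have ? := dE t.
  apply: (@is_derive_eq _ R R (w ^+ 2 * E)).
  by rewrite /GRing.scale /= exprfctE; ring.
have cg : {within `[0, v], continuous g}.
  move=> t; apply: cvgM; first by apply: cvgM; exact: cw.
  have cE : {within `[0, v], continuous E}.
    by apply: derivable_within_continuous => r _; have [] := dE r.
  exact: cE.
move: v0; rewrite le_eqVlt => /predU1P[<- //|v0].
have [c cv] := MVT v0 dg cg.
rewrite {2}/g w0 expr0n mul0r !subr0 => gv.
have Epos t : 0 < E t by exact: expR_gt0.
have wdw : w c * dw c <= M * w c ^+ 2.
  rewrite (le_trans (ler_norm _))// normrM -[w c ^+ 2]real_normK ?num_real//.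
  rewrite [leRHS](_ : _ = `|w c| * (M * `|w c|)); last by ring.
  by rewrite ler_wpM2l// dwle.
have : g v <= 0.
  by rewrite gv mulr_le0_ge0 ?(ltW v0)// mulr_ge0_le0 ?subr_le0// mulr_ge0// ltW.
rewrite /g pmulr_lle0// => wv.
by apply/eqP; rewrite -sqrf_eq0 eq_le wv sqr_ge0.
Qed.

(** * The explosive solution *)

Definition blowup {R : realType} (a t : R) : R := a / (1 - a * t).

Section blowup.
Context {R : realType} (a : R) (a0 : 0 < a).

Lemma blowup_den_gt0 t : t < a^-1 -> 0 < 1 - a * t.
Proof. by move=> ta; rewrite subr_gt0 mulrC -ltr_pdivlMr// mul1r. Qed.

Lemma blowup_gt0 t : t < a^-1 -> 0 < blowup a t.
Proof. by move=> ta; rewrite divr_gt0// blowup_den_gt0. Qed.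

Lemma ler_blowup s t : s <= t -> t < a^-1 -> blowup a s <= blowup a t.
Proof.
move=> st ta; have sa := le_lt_trans st ta.
rewrite ler_pM2l// lef_pV2 ?posrE ?blowup_den_gt0//.
by rewrite lerD2l lerN2 ler_pM2l.
Qed.

(** A difference-quotient form of [u' = u ^ 2] that holds exactly, and hence
    gives the remainder in the Davie estimate in closed form. *)
Lemma blowup_increment s t : s < a^-1 -> t < a^-1 ->
  blowup a t - blowup a s = (t - s) * (blowup a t * blowup a s).
Proof.
move=> /blowup_den_gt0 sa /blowup_den_gt0 ta.
by rewrite /blowup; field; rewrite !gt_eqF.
Qed.

Lemma is_derive_blowup t : t < a^-1 ->
  is_derive t 1 (blowup a) (blowup a t ^+ 2).
Proof.
move=> /blowup_den_gt0 da.
have dd : is_derive t 1 (fun r : R => 1 - a * r) (- a).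
  apply: (@is_derive_eq _ R R (cst 1 - a \*: id)).
  by rewrite /GRing.scale /= mulr1 sub0r.
have ? := is_deriveV (f := fun r : R => 1 - a * r) (lt0r_neq0 da) dd.
apply: (@is_derive_eq _ R R (a \*: (fun r : R => (1 - a * r)^-1))).
by rewrite /GRing.scale /= /blowup; field; rewrite gt_eqF.
Qed.

Lemma continuous_blowup t : t < a^-1 -> {for t, continuous (blowup a)}.
Proof.
by move=> /is_derive_blowup[+ _]; move/derivable1_diffP/differentiable_continuous.
Qed.

Lemma cvgy_blowup : blowup a t @[t --> (a^-1)^'-] --> +oo.
Proof.
apply/cvgryPge => A.
(* [1 - a * t < a / B] as soon as [1 / a - 1 / B < t]. *)
pose B := `|A| + 1.
have B0 : 0 < B by rewrite ltr_wpDl.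
near=> t.
have ta : t < a^-1 by near: t; exact: nbhs_left_lt.
have tB : a^-1 - B^-1 < t.
  by near: t; apply: nbhs_left_gt; rewrite gtrBl invr_gt0.
apply: (@le_trans _ _ B); first by rewrite /B; have := ler_norm A; lra.
rewrite /blowup ler_pdivlMr ?blowup_den_gt0//.
move: tB; rewrite ltrBlDr -ltrBlDl -(ltr_pM2l a0) mulrBr mulfV ?gt_eqF//.
rewrite -(ltr_pM2l B0) mulrCA mulfV ?gt_eqF// mulr1; exact: ltW.
Unshelve. all: end_near. Qed.

Lemma blowup_eq_integral t : 0 <= t -> t < a^-1 ->
  ((blowup a t)%:E = a%:E +
    \int[lebesgue_measure]_(s in `[0%R, t]) (blowup a s ^+ 2)%:E)%E.
Proof.
rewrite le_eqVlt => /predU1P[<- _|t0 ta].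
  by rewrite set_itv1 integral_set1 adde0 /blowup mulr0 subr0 divr1.
have lta s : s \in `[0, t] -> s < a^-1.
  by rewrite in_itv /= => /andP[_ /le_lt_trans]; exact.
rewrite (continuous_FTC2 (F := blowup a)) //.
- by rewrite -EFinB -EFinD {3}/blowup mulr0 subr0 divr1 addrC subrK.
- apply: continuous_in_subspaceT => s; rewrite inE /= => /lta sa.
  by apply: cvgM; exact: continuous_blowup.
- split.
  + by move=> s /subset_itv_oo_cc /lta /is_derive_blowup[].
  + apply: cvg_at_right_filter; apply: continuous_blowup; apply: lta.
    by rewrite in_itv /= lexx ltW.
  + by apply: cvg_at_left_filter; exact: continuous_blowup.
- move=> s /subset_itv_oo_cc /lta /is_derive_blowup ds.
  by rewrite derive1E derive_val.
Qed.

End blowup.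

Lemma rde_remainderE (R : realType) (y : R -> R * R) (s t : R) :
  y t - y s - vf_app sine_field (y s) (lvl1 (incr area_path s t))
    - fgradf sine_field (y s) (lvl2 (incr area_path s t))
  = y t - y s - (t - s) *: drift (y s).
Proof.
by rewrite fgradf_sine_field lvl1_incr_area_path lvl2_incr_area_path
  /vf_app scale0r subr0.
Qed.

Lemma rde_solution_blowup (R : realType) (a : R) : 0 < a ->
  rde_solution sine_field area_path (a, 0) a^-1 (fun t => (blowup a t, 0)).
Proof.
move=> a0; split.
- apply: continuous_in_subspaceT => t; rewrite inE /= in_itv /= => /andP[_ ta].
  have c0 : {for t, continuous (fun=> 0 : R)} by exact: cvg_cst.
  exact: (cvg_pair (continuous_blowup _ a0 _ ta) c0).
- by rewrite /blowup mulr0 subr0 divr1.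
move=> u v u0 uv va; exists 2, (blowup a v ^+ 3); split; first lra.
move=> s t us st tv; rewrite (rde_remainderE _ (fun t => (blowup a t, 0))).
have ta := le_lt_trans tv va; have sa := le_lt_trans st ta.
have h0 : 0 <= t - s by rewrite subr_ge0.
have bs0 := blowup_gt0 _ a0 _ sa; have bt0 := blowup_gt0 _ a0 _ ta.
rewrite [in leLHS](_ : _ - _ =
    ((t - s) ^+ 2 * (blowup a s ^+ 2 * blowup a t), 0)); last first.
  congr pair; rewrite /drift /= ?sin0 ?cos0 /GRing.scale /=; last by ring.
  rewrite blowup_increment//.
  have /eqP := blowup_increment _ a0 _ _ sa ta.
  by rewrite subr_eq => /eqP {1}->; ring.
rewrite prod_normE /= normr0 (@ger0_norm _ (t - s))// powR_mulrn//.
have lest : blowup a s <= blowup a v.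
  by apply: (ler_blowup _ a0 s v _ va); exact: le_trans st tv.
have letv : blowup a t <= blowup a v by exact: ler_blowup.
have C0 : 0 <= blowup a v by rewrite ltW// blowup_gt0.
have R0 : 0 <= (t - s) ^+ 2 * (blowup a s ^+ 2 * blowup a t).
  by rewrite mulr_ge0 ?sqr_ge0// mulr_ge0 ?sqr_ge0// ltW.
rewrite (max_idPl _) ger0_norm// mulrC ler_wpM2r ?sqr_ge0//.
rewrite [leRHS]exprSr ler_pM ?sqr_ge0 ?(ltW bt0)//.
by rewrite ler_sqr ?nnegrE// ltW.
Qed.

(** * Uniqueness *)

Lemma ler_norm_sin (R : realType) (x : R) : `|sin x| <= `|x|.
Proof.
wlog x0 : x / 0 <= x.
  have [|/ltW x0 H] := leP 0 x; first by move=> x0; exact.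
  by rewrite -normrN -sinN -[leRHS]normrN H// oppr_ge0.
have csin : {within `[0, x], continuous (@sin R)}.
  exact/continuous_subspaceT/continuous_sin.
have [c _] := MVT_segment x0 (fun r _ => is_derive_sin r) csin.
rewrite sin0 !subr0 => ->.
by rewrite normrM ler_piMl// ler_norml cos_geN1 cos_le1.
Qed.

Lemma drift_cvg (R : realType) (T : Type) (F : set_system T) (FF : Filter F)
    (z : T -> R * R) (l : R * R) :
  z @ F --> l ->
  ((drift (z t)).1 @[t --> F] --> (drift l).1) /\
  ((drift (z t)).2 @[t --> F] --> (drift l).2).
Proof.
move=> zl.
have z1 : (z t).1 @[t --> F] --> l.1 by apply: (cvg_comp _ _ zl); exact: cvg_fst.
have z2 : (z t).2 @[t --> F] --> l.2 by apply: (cvg_comp _ _ zl); exact: cvg_snd.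
have s2 : sin (z t).2 @[t --> F] --> sin l.2.
  by apply: (cvg_comp _ _ z2); exact: continuous_sin.
have c2 : cos (z t).2 @[t --> F] --> cos l.2.
  by apply: (cvg_comp _ _ z2); exact: continuous_cos.
split; last exact: cvgM.
by apply: cvgD; apply: cvgM => //; apply: cvgM.
Qed.

Lemma rde_solution_is_derive (R : realType) (a : R * R) (T : R)
    (z : R -> R * R) (t : R) :
  rde_solution sine_field area_path a T z -> 0 < t -> t < T ->
  is_derive t 1 (fst \o z) (drift (z t)).1 /\
  is_derive t 1 (snd \o z) (drift (z t)).2.
Proof.
move=> [cz _ rz] t0 tT.
pose v := (t + T) / 2.
have tv : t < v by rewrite /v; lra.
have vT : v < T by rewrite /v; lra.
have v0 : 0 <= v by lra.
have czt : {for t, continuous z}.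
  apply: (@within_continuous_continuous R R _ 0 v z t) => //.
  - by rewrite (lt_trans t0).
  - apply: continuous_subspaceW cz => r /=; rewrite !in_itv /= => /andP[-> rv].
    exact: le_lt_trans rv vT.
  - by rewrite in_itv /= t0.
have [c1 c2] := drift_cvg _ _ _ _ _ _ czt.
have [theta [C [th H]]] := rz 0 v (lexx _) v0 vT.
have {}H r s : 0 <= r -> r <= s -> s <= v ->
  `|(z s).1 - (z r).1 - (s - r) * (drift (z r)).1| <= C * `|s - r| `^ theta /\
  `|(z s).2 - (z r).2 - (s - r) * (drift (z r)).2| <= C * `|s - r| `^ theta.
  move=> r0 rs sv; have := H r s r0 rs sv.
  by rewrite rde_remainderE prod_normE ge_max => /andP[].
split.
- apply: (@is_derive_of_increments _ (fst \o z) (fun s => (drift (z s)).1)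
    0 v C theta) => // r s r0 rs sv.
  by have [] := H r s r0 rs sv.
- apply: (@is_derive_of_increments _ (snd \o z) (fun s => (drift (z s)).2)
    0 v C theta) => // r s r0 rs sv.
  by have [] := H r s r0 rs sv.
Qed.

(** Writing [w] for [z_2], resp. [(1 - a * t) * z_1 - a], the equation gives
    [w' = z_1 * sin w], resp. (once [z_2 = 0]) [w' = z_1 * w]. In both cases
    [|w'| <= M * |w|] with [M] a bound of [|z_1|] on the compact interval, so
    [gronwall_eq0] applies. *)
Lemma rde_solution_first_integrals (R : realType) (a T v : R) (z : R -> R * R) :
  rde_solution sine_field area_path (a, 0) T z -> 0 <= v -> v < T ->
  (z v).2 = 0 /\ (1 - a * v) * (z v).1 = a.
Proof.
move=> zsol v0 vT; have [cz z0 _] := zsol.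
have dz (t : R) : t \in `]0, v[ -> is_derive t 1 (fst \o z) (drift (z t)).1 /\
    is_derive t 1 (snd \o z) (drift (z t)).2.
  rewrite in_itv /= => /andP[t0 tv].
  exact: (rde_solution_is_derive _ _ _ _ _ zsol t0 (lt_trans tv vT)).
have cz1 : {within `[0, v], continuous (fst \o z)}.
  apply: (@continuous_subspaceW _ _ _ `[0, T[).
    move=> r /=; rewrite !in_itv /= => /andP[-> rv].
    exact: le_lt_trans rv vT.
  by move=> t; apply: (cvg_comp _ _ (cz t)); exact: cvg_fst.
have cz2 : {within `[0, v], continuous (snd \o z)}.
  apply: (@continuous_subspaceW _ _ _ `[0, T[).
    move=> r /=; rewrite !in_itv /= => /andP[-> rv].
    exact: le_lt_trans rv vT.
  by move=> t; apply: (cvg_comp _ _ (cz t)); exact: cvg_snd.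
have [M z1M] : exists M : R, forall t : R, t \in `[0, v] -> `|(z t).1| <= M.
  have cn : {within `[0, v], continuous (fun t => `|(z t).1|)}.
    by move=> t; apply: cvg_norm; exact: cz1.
  by have [c _ cM] := EVT_max v0 cn; exists `|(z c).1|.
have z20 (t : R) : t \in `[0, v] -> (z t).2 = 0.
  rewrite in_itv /= => /andP[t0 tv].
  have sub : {subset `]0, t[ <= `]0, v[} by apply: subset_itvl; rewrite bnd_simp.
  apply: (@gronwall_eq0 _ (snd \o z) (fun s => (drift (z s)).2) t M) => //.
  - apply: continuous_subspaceW cz2; exact: subset_itvl.
  - by move=> s /sub /dz[].
  - move=> s /sub sv; rewrite /drift /= normrM mulrC.
    apply: ler_pM => //; first by apply: z1M; exact: subset_itv_oo_cc.
    exact: ler_norm_sin.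
  - by rewrite /= z0.
split; first by apply: z20; rewrite in_itv /= lexx v0.
apply/eqP; rewrite -subr_eq0; apply/eqP.
pose w (t : R) : R := (1 - a * t) * (z t).1 - a.
apply: (@gronwall_eq0 _ w (fun t => (z t).1 * w t) v M) => //.
- move=> t; apply: cvgB; last exact: cvg_cst.
  apply: cvgM; last exact: cz1.
  have cl : {within `[0, v], continuous (fun r : R => 1 - a * r)}.
    apply: continuous_subspaceT => r; apply: cvgB; first exact: cvg_cst.
    by apply: cvgM; [exact: cvg_cst|exact: cvg_id].
  exact: cl.
- move=> t tv; have [dz1 _] := dz t tv.
  apply: (@is_derive_eq _ R R ((cst 1 - a \*: id) * (fst \o z) - cst a)).
  rewrite /GRing.scale /= /drift /= z20 ?cos0 ?sin0; last exact: subset_itv_oo_cc.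
  rewrite /w (_ : (cst 1 - a \*: id) t = 1 - a * t)//; ring.
- move=> t tv; rewrite normrM ler_wpM2r//.
  by apply: z1M; exact: subset_itv_oo_cc.
- by rewrite /w z0 /= mulr0 subr0 mul1r subrr.
Qed.

Theorem mainTheorem3 (R : realType) (p : R) (hp2 : 2 <= p) (hp3 : p < 3)
    (a1 : R) (ha1 : 0 < a1) :
  let x : R -> T2 R := fun t => MkT2 0 (t * tens 1 1) in
  let f : R * R -> R * R := fun xi => (sin xi.2 * xi.1, xi.1) in
  let a : R * R := (a1, 0) in
  [/\ rough_path p x, ~ weakly_geometric x & lies_above x (fun=> 0)] /\
  linear_growth f /\
  exists (tau : R) (y : R -> R * R),
    [/\ 0 < tau,
        rde_solution f x a tau y,
        (forall (T : R) (z : R -> R * R), 0 < T -> rde_solution f x a T z ->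
           T <= tau /\ (forall t : R, 0 <= t -> t < T -> z t = y t)),
        (forall t : R, 0 <= t -> t < tau ->
           (y t).2 = 0 /\
           ((y t).1)%:E =
             (a1%:E + \int[lebesgue_measure]_(s in `[0%R, t])
                        (((y s).1 ^+ 2)%R)%:E)%E) &
        explodes_at tau y /\ (y t).1 @[t --> tau^'-] --> +oo].
Proof.
split.
  split; [exact: rough_path_area_path|exact: not_weakly_geometric_area_path|].
  by [].
split; first exact: linear_growth_sine_field.
exists a1^-1, (fun t => (blowup a1 t, 0)); split.
- by rewrite invr_gt0.
- exact: rde_solution_blowup.
- move=> T z T0 zsol.
  have int (t : R) : 0 <= t -> t < T ->
      (z t).2 = 0 /\ (1 - a1 * t) * (z t).1 = a1.
    exact: (rde_solution_first_integrals _ _ _ _ _ zsol).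
  have Tle : T <= a1^-1.
    (* Past the explosion time, the identity at [t = 1 / a1] reads [0 = a1]. *)
    rewrite leNgt; apply/negP => aT.
    have [|_] := int _ _ aT; first by rewrite invr_ge0 ltW.
    by rewrite mulfV ?gt_eqF// subrr mul0r => a10; rewrite -a10 ltxx in ha1.
  split => // t t0 tT; have [z2 z1] := int t t0 tT.
  have d0 := blowup_den_gt0 _ ha1 _ (lt_le_trans tT Tle).
  rewrite [LHS]surjective_pairing z2; congr pair.
  by apply: (mulfI (lt0r_neq0 d0)); rewrite z1 /blowup mulrC divfK ?gt_eqF.
- by move=> t t0 ta; split => //; exact: blowup_eq_integral.
- have cy := cvgy_blowup _ ha1; split => //.
  apply/cvgryPge => A; move/cvgryPge/(_ A) : cy; apply: filterS => t At.
  by rewrite (le_trans At)// prod_normE le_max ler_norm.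
Qed.
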